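(* For every integer $n\ge 1$, the real vector space of (not necessarily continuous) Lie quasi-states on $\mathfrak{sp}(2n,\mathbb{R})$ that are bounded on a neighborhood of zero is infinite-dimensional.
   Context: Here $\mathfrak{sp}(2n,\mathbb{R})$ is the Lie algebra of the group $Sp(2n,\mathbb{R})$ of real symplectic $2n\times 2n$ matrices. A Lie quasi-state on a finite-dimensional real Lie algebra $\mathfrak{g}$ is a function $\zeta:\mathfrak{g}\to\mathbb{R}$ such that whenever $[x_1,x_2]=0$ one has $\zeta(c_1x_1+c_2x_2)=c_1\zeta(x_1)+c_2\zeta(x_2)$ for all $c_1,c_2\in\mathbb{R}$. *)

(* Defs.v *)
From HB Require Import structures.
From mathcomp Require Import all_boot all_order all_algebra.
From mathcomp Require Import all_classical all_reals all_analysis.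
From mathcomp Require Import ring.

Set Implicit Arguments.
Unset Strict Implicit.
Unset Printing Implicit Defensive.

Import Order.TTheory GRing.Theory Num.Theory.
Import numFieldNormedType.Exports.

Local Open Scope classical_set_scope.
Local Open Scope ring_scope.

HB.mixin Record isLieAlgebra (R : fieldType) V of Vector R V := {
  lie : V -> V -> V;
  lieDl : forall (a : R) (x y z : V),
    lie (a *: x + y) z = a *: lie x z + lie y z;
  lieDr : forall (a : R) (x y z : V),
    lie z (a *: x + y) = a *: lie z x + lie z y;
  liexx : forall x : V, lie x x = 0;
  lie_jacobi : forall x y z : V,
    lie x (lie y z) + lie y (lie z x) + lie z (lie x y) = 0
}.

#[short(type="finLieAlgType")]
HB.structure Definition FinLieAlgebra (R : fieldType) :=
  { V of isLieAlgebra R V & Vector R V }.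

Definition lie_quasi_state (R : realType) (g : finLieAlgType R)
    (zeta : g -> R) : Prop :=
  forall x1 x2 : g, lie x1 x2 = 0 ->
  forall c1 c2 : R,
    zeta (c1 *: x1 + c2 *: x2) = c1 * zeta x1 + c2 * zeta x2.

Definition infinite_dimensional (K : fieldType) (V : lmodType K) : Prop :=
  ~ exists (k : nat) (b : 'I_k -> V),
      forall v : V, exists c : 'I_k -> K, v = \sum_(i < k) c i *: b i.

Section Symplectic.
Variables (R : realType) (n : nat).

Definition Jmx : 'M[R]_(n + n) := block_mx 0 1%:M (- 1%:M) 0.

(* The derivative at the identity of M |-> M^T J M, whose fibre over J is
   Sp(2n, R), is this map, so sp(2n, R) is its kernel. *)
Definition sp_map (A : 'M[R]_(n + n)) : 'M[R]_(n + n) :=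
  A^T *m Jmx + Jmx *m A.

Lemma sp_map_is_linear : linear sp_map.
Proof.
move=> a A B; rewrite /sp_map linearP /= mulmxDl mulmxDr -scalemxAl -scalemxAr.
by rewrite scalerDr addrACA.
Qed.

HB.instance Definition _ :=
  GRing.isLinear.Build R 'M[R]_(n + n) 'M[R]_(n + n) _ sp_map
    sp_map_is_linear.

Definition sp_vspace : {vspace 'M[R]_(n + n)} := lker (linfun sp_map).

Lemma sp_vspaceE (A : 'M[R]_(n + n)) :
  (A \in sp_vspace) = (A^T *m Jmx + Jmx *m A == 0).
Proof. by rewrite memv_ker lfunE. Qed.

Definition sp : Type := subvs_of sp_vspace.

HB.instance Definition _ := Vector.on sp.
HB.instance Definition _ := SubType.copy sp (subvs_of sp_vspace).

Definition mx_commutator (A B : 'M[R]_(n + n)) : 'M[R]_(n + n) :=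
  A *m B - B *m A.

Lemma sp_vspace_commutator (A B : 'M[R]_(n + n)) :
  A \in sp_vspace -> B \in sp_vspace -> mx_commutator A B \in sp_vspace.
Proof.
rewrite !sp_vspaceE !addr_eq0 => /eqP hA /eqP hB.
rewrite /mx_commutator linearB /= !trmx_mul mulmxBl mulmxBr.
rewrite -!mulmxA hA hB !mulmxN !mulmxA hA hB !mulNmx !opprK.
by rewrite opprB.
Qed.

Definition sp_lie (x y : sp) : sp :=
  @Subvs _ _ sp_vspace (mx_commutator (vsval x) (vsval y))
    (sp_vspace_commutator (subvsP x) (subvsP y)).

Lemma sp_lieDl (a : R) (x y z : sp) :
  sp_lie (a *: x + y) z = a *: sp_lie x z + sp_lie y z.
Proof.
apply: val_inj; rewrite /= /mx_commutator mulmxDl mulmxDr -scalemxAl -scalemxAr.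
by rewrite scalerBr opprD addrACA.
Qed.

Lemma sp_lieDr (a : R) (x y z : sp) :
  sp_lie z (a *: x + y) = a *: sp_lie z x + sp_lie z y.
Proof.
apply: val_inj; rewrite /= /mx_commutator mulmxDl mulmxDr -scalemxAl -scalemxAr.
by rewrite scalerBr opprD addrACA.
Qed.

Lemma sp_liexx (x : sp) : sp_lie x x = 0.
Proof. by apply: val_inj; rewrite /= /mx_commutator subrr. Qed.

Lemma sp_jacobi (x y z : sp) :
  sp_lie x (sp_lie y z) + sp_lie y (sp_lie z x) + sp_lie z (sp_lie x y) = 0.
Proof.
apply: val_inj; rewrite /= /mx_commutator !mulmxBl !mulmxBr !mulmxA.
move: (_ *m vsval y *m vsval z) (_ *m vsval z *m vsval y).
move: (_ *m vsval x *m vsval z) (_ *m vsval z *m vsval x).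
move: (_ *m vsval x *m vsval y) (_ *m vsval y *m vsval x).
by move=> a b c d e f; apply/matrixP => i j; rewrite !mxE; ring.
Qed.

HB.instance Definition _ :=
  isLieAlgebra.Build R sp sp_lieDl sp_lieDr sp_liexx sp_jacobi.

(* The subspace topology inherited from the space of matrices. *)
HB.instance Definition _ :=
  Topological.copy sp (initial_topology (vsval : sp -> 'M[R]_(n + n))).

Definition locally_bounded_lqs : {pred (sp -> R^o)} :=
  [pred zeta | `[< lie_quasi_state zeta /\
                   bounded_near zeta (nbhs (0 : sp)) >] ].

Lemma locally_bounded_lqsP (zeta : sp -> R^o) :
  reflect (lie_quasi_state zeta /\
           exists U : set sp, nbhs (0 : sp) U /\
             exists M : R, forall x, U x -> `|zeta x| <= M)
          (zeta \in locally_bounded_lqs).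
Proof.
apply: (iffP (asboolP _)) => -[qs].
  move=> /pinfty_ex_gt0[M _ hM]; split=> //.
  by exists [set x | `|zeta x| <= M]; split=> //; exists M.
move=> [U [U0 [M hM]]]; split=> //; exists M; split; first exact: num_real.
move=> N MN /=; apply: filterS U0 => x /hM /le_trans; apply; exact: ltW.
Qed.

Lemma locally_bounded_lqs_submod_closed : submod_closed locally_bounded_lqs.
Proof.
split.
  apply/locally_bounded_lqsP; split.
    by move=> x1 x2 _ c1 c2; rewrite !mulr0 addr0.
  by exists setT; split; [exact: filterT|exists 0 => x _; rewrite normr0].
move=> a f g /locally_bounded_lqsP[qf [U [U0 [M fM]]]].
move=> /locally_bounded_lqsP[qg [V [V0 [N gN]]]].
apply/locally_bounded_lqsP; split.
  move=> x1 x2 x12 c1 c2.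
  by rewrite !fctE (qf _ _ x12) (qg _ _ x12) /GRing.scale /=; ring.
exists (U `&` V); split; first exact: filterI.
exists (`|a| * M + N) => x [Ux Vx].
rewrite (le_trans (ler_normD _ _))// lerD ?gN//.
by rewrite [X in `|X|]/(a * f x) normrM ler_wpM2l ?fM.
Qed.

HB.instance Definition _ := GRing.isSubmodClosed.Build R (sp -> R^o)
  locally_bounded_lqs locally_bounded_lqs_submod_closed.

Record lb_lie_quasi_states := LbLieQuasiState {
  lqs_fun :> sp -> R^o;
  lqs_funP : lqs_fun \in locally_bounded_lqs
}.

HB.instance Definition _ := [isSub for lqs_fun].
HB.instance Definition _ := [Choice of lb_lie_quasi_states by <:].
HB.instance Definition _ :=
  [SubChoice_isSubLmodule of lb_lie_quasi_states by <:].

End Symplectic.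

(* Main.v *)
Require Import Defs.
From HB Require Import structures.
From mathcomp Require Import all_boot all_order all_algebra.
From mathcomp Require Import all_classical all_reals all_analysis.
From mathcomp Require Import zify.

(** Without continuity, a Lie quasi-state may live on a single abelian
    subalgebra.  Let x be a regular nilpotent element of sp(2n, R): with
    N = 2n, x ^+ N = 0 and x ^+ N.-1 <> 0.  Every matrix commuting with x is a
    polynomial c_0 + c_1 x + ... + c_(N-1) x ^+ N.-1 ([commutant_krylov]).
    Put zeta_x(y) = c_1 when y commutes with x, and zeta_x(y) = 0 otherwise.

    On the centralizer of x this is linear.  Off it, additivity could only fail
    for commuting y, z where y centralizes x with c_1 <> 0 and z does not
    centralize x.  This never occurs: if c_1 <> 0, then y - c_0 is x times an
    invertible polynomial in x, hence is regular nilpotent too, so that whatever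
    commutes with y is a polynomial in y and thus commutes with x
    ([commutant_sub], [centralizer_lie_quasi_state]).

    Since c_1 is the restriction of a linear form on all matrices, zeta_x is
    bounded near zero; setting it to zero outside the centralizer of x can only
    decrease its absolute value.

    Infinitely many independent such functions come from the conjugates x_t of
    one x by a one-parameter group of symplectic shears.  The line killed by
    x_t moves with t, so x_s and x_t commute only for s = t
    ([shear_conj_comm]); therefore zeta_(x_s)(x_t) is 1 if s = t, else 0. *)

Set Implicit Arguments.
Unset Strict Implicit.
Unset Printing Implicit Defensive.

Import Order.TTheory GRing.Theory Num.Theory.
Import numFieldNormedType.Exports.

Local Open Scope classical_set_scope.
Local Open Scope ring_scope.

(** * Duality and quasi-states carried by a centralizer *)

(** Writing the v_i in k generators factors the identity matrix of size k.+1
    through size k. *)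
Lemma dual_family_infinite_dimensional (K : fieldType) (V : lmodType K) :
  (forall k, exists (v : 'I_k -> V) (phi : 'I_k -> V -> K),
     (forall i, scalar (phi i)) /\ forall i j, phi j (v i) = (i == j)%:R) ->
  infinite_dimensional V.
Proof.
move=> dual [k [b span]]; have [v [phi [phi_lin phiv]]] := dual k.+1.
have [c cP] := choice (fun i => span (v i)).
suff /mulmx1_min : (\matrix_(i < k.+1, l < k) c i l) *m
    (\matrix_(l < k, j < k.+1) phi j (b l)) = 1%:M by rewrite ltnn.
apply/matrixP => i j; rewrite !mxE -phiv [in RHS]cP.
pose f := GRing.isLinear.Build K V K *%R (phi j) (phi_lin j).
pose phij : {scalar V} := HB.pack (phi j) f.
rewrite -[phi j]/(phij : V -> K) linear_sum.
by apply: eq_bigr => l _; rewrite !mxE linearZ.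
Qed.

(** The hypothesis says that an element of the centralizer of x on which l does
    not vanish has no larger centralizer than x.  So if y1 and y2 commute and
    one of them, or their combination, has a nonzero value, then both y1 and y2
    centralize x, where the function is linear. *)
Lemma centralizer_lie_quasi_state (R : realType) (g : finLieAlgType R) (x : g)
    (l : g -> R) : scalar l ->
  (forall y z, lie x y = 0 -> l y != 0 -> lie y z = 0 -> lie x z = 0) ->
  lie_quasi_state (fun y : g => if lie x y == 0 then l y else 0).
Proof.
move=> l_lin cent y1 y2 y12 c1 c2.
have l0 : l 0 = 0 by have := l_lin (-1) 0 0; rewrite scaler0 addr0 mulN1r addNr.
have lE : l (c1 *: y1 + c2 *: y2) = c1 * l y1 + c2 * l y2.
  by rewrite l_lin -[c2 *: y2]addr0 l_lin l0 addr0.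
have lieE y : lie y (c1 *: y1 + c2 *: y2) = c1 *: lie y y1 + c2 *: lie y y2.
  rewrite lieDr -[c2 *: y2]addr0 lieDr; congr (_ + _).
  by have := lieDr (-1) 0 0 y; rewrite scaler0 addr0 scaleN1r addNr => ->;
    rewrite addr0.
have lieC (y z : g) : lie y z = 0 -> lie z y = 0.
  move=> yz; have := liexx (1 *: y + z).
  by rewrite lieDl !lieDr !liexx yz !scaler0 !scale1r !addr0 add0r.
have [xy1|xy1] := eqVneq (lie x y1) 0; have [xy2|xy2] := eqVneq (lie x y2) 0.
- by rewrite lieE xy1 xy2 !scaler0 addr0 eqxx lE.
- have ly1 : l y1 = 0.
    by apply: contra_neq_eq xy2 => ly1; exact: cent xy1 ly1 y12.
  rewrite lieE xy1 scaler0 add0r scaler_eq0 (negPf xy2) orbF ly1 !mulr0 addr0.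
  by case: eqP => // c20; rewrite lE ly1 c20 mulr0 mul0r addr0.
- have ly2 : l y2 = 0.
    by apply: contra_neq_eq xy1 => ly2; exact: cent xy2 ly2 (lieC _ _ y12).
  rewrite lieE xy2 scaler0 addr0 scaler_eq0 (negPf xy1) orbF ly2 !mulr0 addr0.
  by case: eqP => // c10; rewrite lE ly2 c10 mulr0 mul0r addr0.
- rewrite !mulr0 addr0; case: eqP => // xy; apply: contra_neq_eq xy1 => ly.
  by apply: cent xy ly _; apply: lieC; rewrite lieE liexx y12 !scaler0 addr0.
Qed.

(** * Commutants of regular nilpotent matrices *)

(** The algebra structure on square matrices needs a size of the form n.+1,
    while the ring structure does not; hence this form of [scalerAl]. *)
Lemma mx_scaleAl (F : fieldType) (N : nat) (a : F) (y z : 'M[F]_N) :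
  a *: (y * z) = a *: y * z.
Proof. exact: scalemxAl. Qed.

Lemma mx_scaleAr (F : fieldType) (N : nat) (a : F) (y z : 'M[F]_N) :
  a *: (y * z) = y * (a *: z).
Proof. exact: scalemxAr. Qed.

Section Krylov.
Variables (F : fieldType) (N : nat).
Implicit Types (v : 'rV[F]_N) (w y z : 'M[F]_N).

Definition krylov v w : 'M[F]_N := \matrix_(i < N) (v *m w ^+ i).

Definition krylov_coord v w y : 'rV[F]_N := v *m y *m invmx (krylov v w).

Lemma mul_krylov v w (u : 'rV[F]_N) :
  u *m krylov v w = v *m (\sum_(i < N) u 0 i *: w ^+ i).
Proof.
rewrite mulmx_sum_row mulmx_sumr; apply: eq_bigr => i _.
by rewrite rowK scalemxAr.
Qed.

(** A linear relation between the v w^i has all its coefficients zero: multiply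
    it by w ^+ (N.-1 - i), where i is the least index of a nonzero coefficient,
    and only the i-th term survives. *)
Lemma krylov_unit v w :
  w ^+ N = 0 -> v *m w ^+ N.-1 != 0 -> krylov v w \in unitmx.
Proof.
move=> wN vw; rewrite -row_free_unit; apply: inj_row_free => u uK.
suff u0 (m : nat) (i : 'I_N) : (i < m)%N -> u 0 i = 0.
  by apply/rowP => i; rewrite mxE (u0 i.+1).
elim: m i => [//|m IH] i; rewrite ltnS leq_eqVlt => /predU1P[im|/IH//].
have w0 k : (N <= k)%N -> w ^+ k = 0.
  by move=> /subnK <-; rewrite exprD wN mulr0.
have iN : (i <= N.-1)%N by rewrite -ltnS (ltn_predK (ltn_ord i)).
have : u *m krylov v w *m w ^+ (N.-1 - i) = 0 by rewrite uK mul0mx.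
rewrite mul_krylov -mulmxA mulmx_suml (bigD1 i)//= big1 ?addr0 => [|j ji].
  rewrite -scalemxAl mulmxE -exprD subnKC//.
  by rewrite -scalemxAr => /eqP; rewrite scaler_eq0 (negPf vw) orbF => /eqP.
have [jm|mj] := ltnP j m; first by rewrite IH// scale0r mul0mx.
rewrite -scalemxAl mulmxE -exprD w0 ?scaler0//.
have ij : (i < j)%N by rewrite ltn_neqAle im mj -im eq_sym ji.
rewrite addnBA// -addnBAC ?(ltnW ij)// -[leqLHS](ltn_predK (ltn_ord i)).
by rewrite -[leqLHS]add1n leq_add2r subn_gt0.
Qed.

(** Expand v z in the basis of the v w^i to get a polynomial z' in w such that
    v z = v z'.  As z and z' both commute with w, they agree on every v w^i, so
    they are equal. *)
Lemma commutant_krylov v w z :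
  w ^+ N = 0 -> v *m w ^+ N.-1 != 0 -> z * w = w * z ->
  z = \sum_(i < N) krylov_coord v w z 0 i *: w ^+ i.
Proof.
move=> wN vw zw; set z' := \sum_(i < N) _.
have Ku := krylov_unit wN vw.
have vz : v *m z = v *m z' by rewrite -mul_krylov mulmxKV.
have comX y i : y * w = w * y -> y * w ^+ i = w ^+ i * y.
  by move=> yw; apply: commrX.
have z'w : z' * w = w * z'.
  rewrite mulr_suml mulr_sumr; apply: eq_bigr => i _.
  by rewrite -mx_scaleAl -mx_scaleAr -exprSr -exprS.
have : krylov v w *m z = krylov v w *m z'.
  apply/row_matrixP => i; rewrite !row_mul !rowK -!mulmxA !mulmxE.
  by rewrite -!comX// -!mulmxE !mulmxA vz.
by move/(congr1 (mulmx (invmx (krylov v w)))); rewrite !mulKmx.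
Qed.

Lemma krylov_coord_self v w (j : 'I_N) :
  w ^+ N = 0 -> v *m w ^+ N.-1 != 0 ->
  krylov_coord v w (w ^+ j) = delta_mx 0 j.
Proof.
move=> wN vw; rewrite /krylov_coord.
have -> : v *m w ^+ j = delta_mx 0 j *m krylov v w by rewrite -rowE rowK.
by rewrite mulmxK ?krylov_unit.
Qed.

(** The centralizer of w is the smallest possible one among those of its
    polynomials with nonzero linear coefficient: such a y, once its constant
    term is removed, is again regular nilpotent, with the same cyclic vector
    v. *)
Lemma commutant_sub v w y z (j : 'I_N) : j = 1%N :> nat ->
  w ^+ N = 0 -> v *m w ^+ N.-1 != 0 -> y * w = w * y ->
  krylov_coord v w y 0 j != 0 -> z * y = y * z -> z * w = w * z.
Proof.
move=> j1 wN vw yw; move: (commutant_krylov wN vw yw).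
move: (krylov_coord v w y) => c; move=> yE c1 zy.
have [q wq yq] : exists2 q, q * w = w * q &
    exists a, y = a%:M + w * ((c 0 j)%:M + w * q).
  (* q collects the terms of y of degree at least 2, divided by w ^+ 2. *)
  case: (N) v w y z j j1 wN vw yw c yE c1 zy => [|[|k]] v0 w0 y0 z0 j;
    [by case: j|by move=> j1; have := ltn_ord j; rewrite j1|].
  move=> j1 _ _ _ c yE _ _.
  exists (\sum_(i < k) c 0 (lift ord0 (lift ord0 i)) *: w0 ^+ i).
    rewrite mulr_suml mulr_sumr; apply: eq_bigr => i _.
    by rewrite -mx_scaleAl -mx_scaleAr -exprSr -exprS.
  exists (c 0 0); rewrite [LHS]yE !big_ord_recl expr0 expr1.
  have -> : j = lift ord0 ord0 by apply: val_inj.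
  rewrite scalemx1 mulrDr; congr (_ + (_ + _)).
    by rewrite -mulmxE mul_mx_scalar.
  rewrite !mulr_sumr; apply: eq_bigr => i _.
  by rewrite -!mx_scaleAr /= /bump /= !add1n !exprS.
case: yq => a; set u := (c 0 j)%:M + w * q; set w' := w * u => yE'.
have wu : GRing.comm w u.
  rewrite /GRing.comm /u mulrDl mulrDr -mulrA wq -!mulmxE.
  by rewrite mul_mx_scalar mul_scalar_mx.
have ww' : w' * w = w * w' by rewrite /w' -mulrA -wu.
have w'N : w' ^+ N = 0 by rewrite exprMn_comm// wN mul0r.
have N0 : (0 < N)%N by apply: leq_ltn_trans (ltn_ord j).
(* As w ^+ N.-1 * w = 0, only the constant term of u acts on w ^+ N.-1. *)
have wu1 k : w ^+ N.-1 * u ^+ k = (c 0 j) ^+ k *: w ^+ N.-1.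
  elim: k => [|k IH]; first by rewrite !expr0 mulr1 scale1r.
  rewrite exprSr mulrA IH -mx_scaleAl /u mulrDr mulrA -exprSr prednK// wN mul0r.
  by rewrite addr0 -mulmxE mul_mx_scalar scalerA exprSr.
have vw' : v *m w' ^+ N.-1 != 0.
  by rewrite exprMn_comm// wu1 -scalemxAr scaler_eq0 negb_or expf_neq0.
have zw' : z * w' = w' * z.
  have -> : w' = y - a%:M by rewrite yE' addrC addKr.
  by rewrite mulrBl mulrBr zy -!mulmxE mul_mx_scalar mul_scalar_mx.
rewrite (commutant_krylov w'N vw' zw') mulr_suml mulr_sumr.
apply: eq_bigr => i _; rewrite -mx_scaleAl -mx_scaleAr; congr (_ *: _).
by apply/commr_sym/commrX; rewrite /GRing.comm ww'.
Qed.

Lemma krylov_coord_scalar v w (j : 'I_N) :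
  scalar (fun y => krylov_coord v w y 0 j).
Proof.
by move=> a y z; rewrite /krylov_coord linearP mulmxDl -scalemxAl /= !mxE.
Qed.

End Krylov.

(** * Matrices that shift a basis along a chain *)

(** Read h i as the place of the i-th basis vector on a chain of length N: X
    sends it to a nonzero multiple of the next one, and kills the last one. *)
Section Chain.
Variables (F : fieldType) (N : nat) (h : 'I_N -> 'I_N) (X : 'M[F]_N).
Hypotheses (h_inj : injective h)
  (XE : forall i j, (X i j != 0) = (h j == (h i).+1 :> nat)).

Lemma chain_exp k i j : ((X ^+ k) i j != 0) = (h j == (h i + k)%N :> nat).
Proof.
elim: k i j => [|k IH] i j.
  rewrite expr0 mxE addn0 val_eqE (inj_eq h_inj) [RHS]eq_sym.
  by case: (i == j); rewrite ?oner_eq0 ?eqxx.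
rewrite exprS -mulmxE mxE; have [hN|Nh] := ltnP (h i).+1 N.
  have /codomP[l hl] := injF_onto h_inj (Ordinal hN).
  have hlE : h l = (h i).+1 :> nat by rewrite -hl.
  rewrite (bigD1 l)//= big1 ?addr0 => [|l' ll'].
    by rewrite mulf_eq0 negb_or IH XE hlE eqxx addSnnS.
  suff /eqP -> : X i l' == 0 by rewrite mul0r.
  by rewrite -[_ == 0]negbK XE -hlE val_eqE (inj_eq h_inj).
rewrite big1 ?eqxx => [|l _].
  by apply/esym/negbTE; rewrite neq_ltn (leq_trans (ltn_ord _))// addnS
    (leq_trans Nh)// ltnS leq_addr.
suff /eqP -> : X i l == 0 by rewrite mul0r.
by rewrite -[_ == 0]negbK XE neq_ltn (leq_trans (ltn_ord _)).
Qed.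

Lemma chain_nilpotent : X ^+ N = 0.
Proof.
apply/matrixP => i j; apply/eqP; rewrite mxE -[_ == 0]negbK chain_exp.
by rewrite neq_ltn (leq_trans (ltn_ord _))// leq_addl.
Qed.

Lemma chain_cyclic i : h i = 0%N :> nat -> row i (X ^+ N.-1) != 0.
Proof.
move=> hi; have N0 : (N.-1 < N)%N by rewrite (ltn_predK (ltn_ord i)).
have /codomP[j hj] := injF_onto h_inj (Ordinal N0).
apply/eqP => /rowP /(_ j) /eqP; rewrite !mxE -[_ == 0]negbK chain_exp.
by rewrite -hj hi add0n eqxx.
Qed.

End Chain.

(** * Conjugation by shears *)

Section Shear.
Variables (F : fieldType) (N : nat).
Implicit Types (M X : 'M[F]_N) (s t : F).

Definition shear M t : 'M[F]_N := 1 + t *: M.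

Definition shear_conj M X t : 'M[F]_N := shear M t * X * shear M (- t).

Lemma shearD M s t : M * M = 0 -> shear M s * shear M t = shear M (s + t).
Proof.
move=> M2; rewrite /shear mulrDl mul1r mulrDr mulr1 -mx_scaleAl -mx_scaleAr M2.
by rewrite !scaler0 addr0 -addrA -scalerDl [t + s]addrC.
Qed.

Lemma shear0 M : shear M 0 = 1.
Proof. by rewrite /shear scale0r addr0. Qed.

Lemma shearK M t : M * M = 0 -> shear M (- t) * shear M t = 1.
Proof. by move=> M2; rewrite shearD// addNr shear0. Qed.

Lemma shear_conjX M X t k : M * M = 0 ->
  shear_conj M X t ^+ k = shear_conj M (X ^+ k) t.
Proof.
move=> M2; elim: k => [|k IH].
  by rewrite /shear_conj !expr0 mulr1 shearD// subrr shear0.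
rewrite exprS IH /shear_conj exprS !mulrA -[_ * shear M (- t) * _]mulrA.
by rewrite shearK// mulr1.
Qed.

End Shear.

Section ShearedChains.
Variables (F : fieldType) (N : nat) (h : 'I_N -> 'I_N) (X M : 'M[F]_N).
Hypotheses (h_inj : injective h)
  (XE : forall i j, (X i j != 0) = (h j == (h i).+1 :> nat)).
Variables (i0 iN : 'I_N).
Hypotheses (h0 : h i0 = 0%N :> nat) (hN : h iN = N.-1 :> nat) (N1 : (1 < N)%N).
Hypotheses (M2 : M * M = 0) (iNM : row iN M = delta_mx 0 i0).

Let e : 'rV[F]_N := delta_mx 0 iN.

Lemma shear_conj_nilpotent t : shear_conj M X t ^+ N = 0.
Proof.
by rewrite shear_conjX// (chain_nilpotent h_inj XE) /shear_conj mulr0 mul0r.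
Qed.

Lemma shear_conj_cyclic t :
  row i0 (shear M (- t)) *m shear_conj M X t ^+ N.-1 != 0.
Proof.
rewrite shear_conjX// /shear_conj rowE -mulmxA mulmxE 2!mulrA shearK// mul1r.
rewrite -mulmxE mulmxA -rowE; apply: contra_neq (chain_cyclic h_inj XE h0).
move/(congr1 (mulmx^~ (shear M t))).
by rewrite -mulmxA mulmxE shearK// mul0mx mulmx1.
Qed.

Lemma chain_last : e *m X = 0.
Proof.
rewrite /e -rowE; apply/rowP => j; rewrite !mxE; apply/eqP.
rewrite -[_ == 0]negbK XE hN (ltn_predK N1).
by rewrite neq_ltn ltn_ord.
Qed.

(** A chain matrix is injective on the span of all basis vectors but the last,
    so its left kernel is a line. *)
Lemma chain_left_kernel (u : 'rV[F]_N) : u *m X = 0 -> u = u 0 iN *: e.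
Proof.
move=> uX; apply/rowP => i; rewrite !mxE eqxx /=.
have [->|iiN] := eqVneq i iN; first by rewrite mulr1.
rewrite mulr0; apply/eqP.
have iN' : ((h i).+1 < N)%N.
  rewrite ltn_neqAle ltn_ord andbT; apply: contra_neq iiN => hiN.
  by apply/h_inj/val_inj; rewrite /= hN -[in RHS]hiN.
have /codomP[j hj] := injF_onto h_inj (Ordinal iN').
have hjE : h j = (h i).+1 :> nat by rewrite -hj.
move/rowP : uX => /(_ j); rewrite !mxE (bigD1 i)//= big1 ?addr0 => [|l li].
  by move/eqP; rewrite mulf_eq0 -[X in _ || X]negbK XE hjE eqxx orbF.
suff /eqP -> : X l j == 0 by rewrite mulr0.
rewrite -[_ == 0]negbK XE hjE eqSS val_eqE (inj_eq h_inj) eq_sym.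
by rewrite (negPf li).
Qed.

(** The left kernel of shear_conj M X t is the line spanned by
    v = e *m shear M (- t).  A matrix that commutes with this one maps the line
    to itself, and if it is nilpotent it kills the line.  Applied to
    shear_conj M X s, this says that X kills e *m shear M (s - t), which is
    e + (s - t) times the first vector of the chain; X kills e but not that
    first vector, whence s = t. *)
Lemma shear_conj_comm s t :
  shear_conj M X s * shear_conj M X t = shear_conj M X t * shear_conj M X s ->
  s = t.
Proof.
move=> st; set g := shear M in st *; set v := e *m g (- t).
have gg a b : g a * g b = g (a + b) by exact: shearD.
have xg a : shear_conj M X a *m g a = g a *m X.
  by rewrite /shear_conj !mulmxE -mulrA shearK// mulr1.
have vt : v *m shear_conj M X t = 0.
  by rewrite /v -mulmxA /shear_conj mulmxE 2!mulrA shearK// mul1r -mulmxE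
    mulmxA chain_last mul0mx.
have [l vs] : exists l, v *m shear_conj M X s = l *: v.
  have : v *m shear_conj M X s *m g t *m X = 0.
    by rewrite -(mulmxA _ (g t)) -xg mulmxA -(mulmxA v) mulmxE st -mulmxE mulmxA
      vt !mul0mx.
  move/chain_left_kernel; move: (X in X *: e) => l vsE; exists l.
  rewrite /v scalemxAl -vsE -(mulmxA _ (g t)) mulmxE gg subrr.
  by rewrite /g shear0 mulmx1.
have v0 : v != 0.
  apply/eqP => /(congr1 (mulmx^~ (g t))) /eqP.
  rewrite /v -mulmxA mulmxE shearK// mul0mx mulmx1 => /eqP /rowP /(_ iN) /eqP.
  by rewrite !mxE !eqxx oner_eq0.
have l0 : l = 0.
  have vsX k : v *m shear_conj M X s ^+ k = l ^+ k *: v.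
    elim: k => [|k IH]; first by rewrite !expr0 mulmx1 scale1r.
    by rewrite exprS -mulmxE mulmxA vs -scalemxAl IH scalerA exprS.
  have /eqP := vsX N; rewrite shear_conj_nilpotent mulmx0 eq_sym.
  rewrite scaler_eq0 (negPf v0) orbF.
  by rewrite expf_eq0 => /andP[_ /eqP].
have : v *m shear_conj M X s *m g s = 0 by rewrite vs l0 scale0r mul0mx.
rewrite -mulmxA xg /v mulmxA -(mulmxA e) mulmxE gg /g /shear mulmxDr mulmx1.
rewrite mulmxDl chain_last add0r.
rewrite -scalemxAr -scalemxAl -rowE iNM => /eqP; rewrite scaler_eq0.
case/orP; first by rewrite addrC subr_eq0 => /eqP.
have /codomP[j hj] := injF_onto h_inj (Ordinal N1).
rewrite -rowE => /eqP /rowP /(_ j) /eqP; rewrite !mxE -[_ == 0]negbK XE.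
by rewrite h0 -hj eqxx.
Qed.

End ShearedChains.

(** * A regular nilpotent symplectic matrix *)

Section SymplecticChain.
Variables (R : realType) (n : nat).

Definition shift_mx : 'M[R]_n := \matrix_(i, j) (j == i.+1 :> nat)%:R.

(** This joins the chain of the first n basis vectors to that of the last n; an
    upper right block must be symmetric for sp_chain to be symplectic. *)
Definition corner_mx : 'M[R]_n :=
  \matrix_(i, j) ((i.+1 == n) && (j.+1 == n))%:R.

Definition sp_chain : 'M[R]_(n + n) :=
  block_mx shift_mx corner_mx 0 (- shift_mx^T).

Definition sp_shear : 'M[R]_(n + n) := block_mx 0 0 1%:M 0.

(** Rows e_0, ..., e_(n-1) of the first block come in order, followed by those
    of the second block in reverse order, because of the transpose in
    sp_chain. *)
Definition chain_pos (i : 'I_(n + n)) : 'I_(n + n) :=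
  match fintype.split i with
  | inl i => lshift n i
  | inr i => rshift n (rev_ord i)
  end.

Lemma chain_posl i : chain_pos (lshift n i) = lshift n i.
Proof. by rewrite /chain_pos (unsplitK (inl i)). Qed.

Lemma chain_posr i : chain_pos (rshift n i) = rshift n (rev_ord i).
Proof. by rewrite /chain_pos (unsplitK (inr i)). Qed.

Lemma chain_pos_inj : injective chain_pos.
Proof.
apply: inv_inj => i.
by case: (split_ordP i) => j ->; rewrite ?(chain_posl, chain_posr) ?rev_ordK.
Qed.

Lemma sp_chainE i j :
  (sp_chain i j != 0) = (chain_pos j == (chain_pos i).+1 :> nat).
Proof.
have bneq0 (b : bool) : (b%:R != 0 :> R) = b.
  by case: b; rewrite ?oner_eq0 ?eqxx.
case: (split_ordP i) => {}i ->; case: (split_ordP j) => {}j ->;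
  rewrite ?chain_posl ?chain_posr /sp_chain
    ?(block_mxEul, block_mxEur, block_mxEdl, block_mxEdr) !mxE ?oppr_eq0
    ?bneq0 //=;
  have := ltn_ord i; have := ltn_ord j; move: (i : nat) (j : nat) => {}i {}j.
- lia.
- by rewrite eqxx; lia.
- lia.
Qed.

End SymplecticChain.

(** * Locally bounded quasi-states on the symplectic algebra *)

Lemma scalar_mx_bounded (R : realType) (m p : nat) (l : 'M[R]_(m, p) -> R) :
  scalar l ->
  exists C, forall A : 'M[R]_(m, p), (forall i j, `|A i j| <= 1) -> `|l A| <= C.
Proof.
move=> l_lin; pose f := GRing.isLinear.Build R 'M[R]_(m, p) R *%R l l_lin.
pose l' : {scalar 'M[R]_(m, p)} := HB.pack l f.
exists (\sum_i \sum_j `|l (delta_mx i j)|) => A A1.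
rewrite {1}[A]matrix_sum_delta -[l]/(l' : _ -> R) linear_sum.
apply: le_trans (ler_norm_sum _ _ _) _; apply: ler_sum => i _.
rewrite linear_sum; apply: le_trans (ler_norm_sum _ _ _) _.
by apply: ler_sum => j _; rewrite linearZ normrM ler_piMl.
Qed.

Section SymplecticQuasiStates.
Variables (R : realType) (n : nat).
Hypothesis n0 : (0 < n)%N.

Lemma sp_scalar_bounded (l : 'M[R]_(n + n) -> R) (zeta : sp R n -> R) :
  scalar l -> (forall y, `|zeta y| <= `|l (vsval y)|) ->
  exists U : set (sp R n), nbhs (0 : sp R n) U /\
    exists C : R, forall y, U y -> `|zeta y| <= C.
Proof.
move=> /scalar_mx_bounded[C lC] zl.
exists (vsval @^-1` ball (0 : 'M[R]_(n + n)) 1); split.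
  have cont := @initial_continuous _ _ (vsval : sp R n -> 'M[R]_(n + n)).
  apply: (cont (0 : sp R n)).
  exact: nbhsx_ballx.
exists C => y y1; apply: le_trans (zl y) _; apply: lC => i j; apply: ltW.
by case: y1 => _ /(_ i j); rewrite mxE /ball/= sub0r normrN.
Qed.

Lemma sp_shear_sq : sp_shear R n * sp_shear R n = 0.
Proof.
by rewrite -mulmxE mulmx_block !mul0mx !mulmx0 !addr0 -block_mx0.
Qed.

Lemma sp_chain_sp : sp_chain R n \in sp_vspace R n.
Proof.
rewrite sp_vspaceE /sp_chain /Jmx tr_block_mx !mulmx_block.
rewrite !(mul0mx, mulmx0, mulmx1, mul1mx, mulmxN, mulNmx, add0r, addr0,
  trmx0, oppr0).
rewrite add_block_mx !(addr0, add0r) -block_mx0; apply/eqP; congr block_mx.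
- by rewrite subrr.
- by rewrite linearN /= trmxK opprK subrr.
- by apply/matrixP => i j; rewrite !mxE andbC subrr.
Qed.

(** The shears are symplectic: transposing one and moving it across the form
    inverts it. *)
Lemma shear_conj_sp t :
  shear_conj (sp_shear R n) (sp_chain R n) t \in sp_vspace R n.
Proof.
have sJ a : (shear (sp_shear R n) a)^T *m Jmx R n =
    Jmx R n *m shear (sp_shear R n) (- a).
  rewrite /shear /sp_shear /Jmx -[1]/(1%:M) linearD linearZ /= trmx1.
  rewrite tr_block_mx.
  rewrite mulmxDl mulmxDr mul1mx mulmx1 -scalemxAl -scalemxAr !mulmx_block.
  rewrite !(mul0mx, mulmx0, mulmx1, mul1mx, mulmxN, mulNmx, add0r, addr0,
    trmx0, trmx1).
  by rewrite scaleNr -scalerN opp_block_mx !oppr0.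
have := sp_chain_sp; rewrite !sp_vspaceE !addr_eq0 => /eqP XJ.
rewrite /shear_conj -!mulmxE.
set g := shear _ t; set g' := shear _ (- t).
have gJ : g^T *m Jmx R n = Jmx R n *m g' by exact: sJ.
have g'J : g'^T *m Jmx R n = Jmx R n *m g by rewrite sJ opprK.
rewrite !trmx_mul -!(mulmxA g'^T) -(mulmxA _ g^T) gJ (mulmxA _ (Jmx R n)) XJ.
by rewrite mulNmx mulmxN -(mulmxA (Jmx R n)) (mulmxA g'^T) g'J !mulmxA.
Qed.

Definition sp_nilpotent (t : R) : sp R n :=
  @Subvs _ _ (sp_vspace R n) _ (shear_conj_sp t).

(* i1 picks out the linear coefficient of a polynomial in x; lshift n o is the
   first place of the chain and rshift n o the last one. *)
Let i1 : 'I_(n + n) := Ordinal (leq_add n0 n0 : (1 < n + n)%N).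
Let o : 'I_n := Ordinal n0.

(** The cyclic row vector is the first vector of the chain, transported along
    the conjugation that turns sp_chain into sp_nilpotent t. *)
Definition sp_coef (t : R) (y : 'M[R]_(n + n)) : R :=
  krylov_coord (row (lshift n o) (shear (sp_shear R n) (- t)))
    (vsval (sp_nilpotent t)) y 0 i1.

Definition sp_zeta (t : R) (y : sp R n) : R^o :=
  if lie (sp_nilpotent t) y == 0 then sp_coef t (vsval y) else 0.

Let pos0 : chain_pos (lshift n o) = 0%N :> nat.
Proof. by rewrite chain_posl. Qed.

Let posN : chain_pos (rshift n o) = (n + n).-1 :> nat.
Proof. by rewrite chain_posr /=; lia. Qed.

Let rowN : row (rshift n o) (sp_shear R n) = delta_mx 0 (lshift n o).
Proof.
apply/rowP => j; rewrite mxE [RHS]mxE; case: (split_ordP j) => {}j ->.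
  by rewrite block_mxEdl !mxE eqxx /= eq_shift eq_sym.
by rewrite block_mxEdr !mxE eq_shift.
Qed.

Lemma sp_lie_eq0 (x y : sp R n) :
  lie x y = 0 <-> vsval x * vsval y = vsval y * vsval x.
Proof.
split=> [/(congr1 vsval)/eqP|xy]; first by rewrite subr_eq0 => /eqP.
by apply/val_inj; rewrite /= /mx_commutator !mulmxE xy subrr.
Qed.

Lemma sp_nilpotentX t : vsval (sp_nilpotent t) ^+ (n + n) = 0.
Proof.
exact: shear_conj_nilpotent (@chain_pos_inj n) (@sp_chainE R n) sp_shear_sq t.
Qed.

Lemma sp_nilpotent_cyclic t :
  row (lshift n o) (shear (sp_shear R n) (- t)) *m
    vsval (sp_nilpotent t) ^+ (n + n).-1 != 0.
Proof.
have := shear_conj_cyclic (@chain_pos_inj n) (@sp_chainE R n) pos0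
  sp_shear_sq t.
by [].
Qed.

Lemma sp_zeta_locally_bounded t : sp_zeta t \in @locally_bounded_lqs R n.
Proof.
have coef_lin : scalar (sp_coef t) by exact: krylov_coord_scalar.
apply/locally_bounded_lqsP; split.
  apply: (@centralizer_lie_quasi_state R (sp R n) (sp_nilpotent t)
    (fun y => sp_coef t (vsval y))).
    by move=> a y z; rewrite -coef_lin.
  move=> y z /sp_lie_eq0 xy cy /sp_lie_eq0 yz; apply/sp_lie_eq0.
  apply/esym/(commutant_sub (j := i1) _ _ _ (esym xy) cy (esym yz)) => //.
    exact: sp_nilpotentX.
  exact: sp_nilpotent_cyclic.
apply: (sp_scalar_bounded coef_lin) => y.
by rewrite /sp_zeta; case: ifP => //; rewrite normr0 normr_ge0.
Qed.

Lemma sp_zetaE s t : sp_zeta s (sp_nilpotent t) = (s == t)%:R.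
Proof.
rewrite /sp_zeta; case: ifPn => [/eqP/sp_lie_eq0 st|].
  have <- : s = t.
    have n1 : (1 < n + n)%N := leq_add n0 n0.
    have := shear_conj_comm (@chain_pos_inj n) (@sp_chainE R n) pos0 posN n1
      sp_shear_sq rowN.
    by apply; exact: st.
  rewrite eqxx /sp_coef -[vsval _ in X in krylov_coord _ _ X]expr1.
  rewrite (krylov_coord_self i1 (sp_nilpotentX _) (sp_nilpotent_cyclic _)).
  by rewrite mxE !eqxx.
by have [->|] := eqVneq s t; rewrite ?liexx ?eqxx.
Qed.

End SymplecticQuasiStates.

Theorem theorem1p2 (R : realType) (n : nat) (hn : (1 <= n)%N) :
  infinite_dimensional (lb_lie_quasi_states R n).
Proof.
apply: dual_family_infinite_dimensional => k.
exists (fun i => LbLieQuasiState (sp_zeta_locally_bounded hn i%:R)).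
exists (fun (j : 'I_k) (z : lb_lie_quasi_states R n) =>
  lqs_fun z (@sp_nilpotent R n j%:R)); split => // i j /=.
by rewrite sp_zetaE eqr_nat.
Qed.
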